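(* Let $G = G_1 * G_2 * \cdots * G_n$ be a finite free product of groups, and suppose each $G_i$ is subgroup separable. Then $G$ is subgroup separable.
   Context: A subgroup $H$ of a group $G$ is \emph{separable in $G$} if for every element $g \in G\smallsetminus H$ there is a finite index subgroup $K$ of $G$ with $H \le K$ and $g \notin K$. A group $G$ is \emph{subgroup separable} if every finitely generated subgroup of $G$ is separable in $G$. *)

(* Defs.v *)
From HB Require Import structures.
From mathcomp Require Import all_boot.
From mathcomp Require Import boolp classical_sets functions cardinality.

Set Implicit Arguments.
Unset Strict Implicit.
Unset Printing Implicit Defensive.

Local Open Scope classical_set_scope.
Local Open Scope group_scope.

(* [groupType] is the library's structure for possibly infinite groups. Its
   [choiceType] part is no restriction on the underlying group: every type
   carries one by [gen_eqMixin] and [gen_choiceMixin]. *)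

Definition is_subgroup (G : groupType) (H : set G) : Prop :=
  [/\ H 1, (forall x y, H x -> H y -> H (x * y))
         & (forall x, H x -> H x^-1)].

Definition generated_subgroup (G : groupType) (S : set G) : set G :=
  smallest (@is_subgroup G) S.

Definition finitely_generated (G : groupType) (H : set G) : Prop :=
  exists S : set G, finite_set S /\ H = generated_subgroup S.

Definition left_coset (G : groupType) (K : set G) (x : G) : set G :=
  [set x * k | k in K].

Definition finite_index (G : groupType) (K : set G) : Prop :=
  finite_set (range (left_coset K)).

Definition separable (G : groupType) (H : set G) : Prop :=
  forall g : G, ~ H g ->
    exists K : set G,
      [/\ is_subgroup K, finite_index K, H `<=` K & ~ K g].

Definition subgroup_separable (G : groupType) : Prop :=
  forall H : set G, is_subgroup H -> finitely_generated H -> separable H.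

(* [G] is the free product of the [Gs i], with canonical maps [iota i]:
   the coproduct of the family in the category of groups. A multiplicative
   map between groups is a group homomorphism. *)
Definition is_free_product (I : Type) (Gs : I -> groupType) (G : groupType)
    (iota : forall i, {multiplicative Gs i -> G}) : Prop :=
  forall (T : groupType) (f : forall i, {multiplicative Gs i -> T}),
    (exists phi : {multiplicative G -> T},
        forall i x, phi (iota i x) = f i x)
    /\ (forall phi psi : {multiplicative G -> T},
          (forall i x, phi (iota i x) = f i x) ->
          (forall i x, psi (iota i x) = f i x) -> phi =1 psi).

(* Main.v *)
Require Import Defs.
From HB Require Import structures.
From mathcomp Require Import all_boot all_fingroup.
From mathcomp Require Import boolp classical_sets functions cardinality.

(** Let H be a finitely generated subgroup of the free product G, let g be
    outside H, and let G act on the right cosets of H. It suffices to find an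
    action of G on a finite set Y and a point of Y that is fixed by the
    generators of H and moved by g: its stabilizer is then the required subgroup
    of finite index. By the universal property, an action of G on Y is nothing
    but an independent choice of an action of every factor on Y.

    Write the generators of H and the element g as products of elements of the
    factors. Following these words from the coset H, one meets only finitely many
    cosets, forming a set F, and uses only finitely many steps x -> x a, with a
    in a factor ([finitely_many_conditions]). So an action on a finite set Y
    containing F will do as soon as it makes these finitely many steps.

    For a single factor A such an action exists, by [finite_model]. Choose a
    representative c in each A-orbit, and for each x in this orbit some p x in A
    with c (p x) = x. Let S_c be the subgroup of A generated by the elements
    p x * a * (p (x a))^-1, for the steps x -> x a in the orbit. It is finitely
    generated and fixes c, so it does not contain p x * (p y)^-1 when x and y are
    distinct points of the orbit. Since A is subgroup separable, there is a finite
    quotient of A in which the images of these elements, for x and y in F, lie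
    outside the images of the corresponding S_c, and the points x = c (p x) can be
    modelled by the cosets S_c (p x) in that quotient.
    The stabilizer of c itself could be used in place of S_c only if it were known
    to be finitely generated, which would require the Kurosh subgroup theorem.

    Finally, the finite sets obtained for the different factors are glued along
    F, each factor acting trivially outside its own set ([amalgamate]). *)

Set Implicit Arguments.
Unset Strict Implicit.
Unset Printing Implicit Defensive.

Local Open Scope classical_set_scope.
Local Open Scope group_scope.

(** * Finite permutation representations *)

(** The product of permutations applies its left factor first, so it is right
    actions that correspond to multiplicative maps. *)
Lemma right_action_perm (A : groupType) (Y : finType) (f : A -> Y -> Y) :
  (forall y, f 1 y = y) -> (forall a b y, f (a * b) y = f b (f a y)) ->
  exists phi : {multiplicative A -> {perm Y}}, forall a y, phi a y = f a y.
Proof.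
move=> f1 fM.
have finj a : injective (f a).
  by move=> x y /(congr1 (f a^-1)); rewrite -!fM mulgV !f1.
pose r a := perm (@finj a).
have rM : {morph r : a b / a * b}.
  by move=> a b; apply/permP => y; rewrite permM !permE fM.
pose phi : {multiplicative A -> {perm Y}} :=
  HB.pack r (isMultiplicative.Build A {perm Y} r rM).
by exists phi => a y; rewrite /= permE.
Qed.

Lemma multiplicative1 (A B : groupType) (f : {multiplicative A -> B}) : f 1 = 1.
Proof. by apply: (mulgI (f 1)); rewrite -gmulfM !mulg1. Qed.

Lemma multiplicativeV (A B : groupType) (f : {multiplicative A -> B}) x :
  f x^-1 = (f x)^-1.
Proof.
by apply: (mulgI (f x)); rewrite -gmulfM !mulgV multiplicative1.
Qed.

(** The group acts trivially outside the image of [j]. *)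
Lemma extend_perm_rep (A : groupType) (Q Y : finType) (j : Q -> Y)
    (phi : {multiplicative A -> {perm Q}}) :
  injective j ->
  exists psi : {multiplicative A -> {perm Y}},
    forall a q, psi a (j q) = j (phi a q).
Proof.
move=> jI.
pose f a y := if [pick q | j q == y] is Some q then j (phi a q) else y.
have fj a q : f a (j q) = j (phi a q).
  by rewrite /f; case: pickP => [q' /eqP/jI -> //|/(_ q)]; rewrite eqxx.
have fN a y : (forall q, j q <> y) -> f a y = y.
  by rewrite /f => Ny; case: pickP => // q /eqP /Ny.
have yP y : (exists q, y = j q) \/ (forall q, j q <> y).
  case: (pselect (exists q, j q = y)) => [[q <-]|/forallNP]; last by right.
  by left; exists q.
have [|a b y|psi psiE] := @right_action_perm A Y f.
- by move=> y; have [[q ->]|/fN->//] := yP y; rewrite fj multiplicative1 perm1.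
- have [[q ->]|Ny] := yP y; last by rewrite !fN.
  by rewrite !fj gmulfM permM.
- by exists psi => a q; rewrite psiE fj.
Qed.

(** The coset of [x] depends only on the permutation by which [x] acts. *)
Lemma point_stabilizer (G : groupType) (Y : finType)
    (Phi : {multiplicative G -> {perm Y}}) (y : Y) :
  is_subgroup [set h | Phi h y = y] /\ finite_index [set h | Phi h y = y].
Proof.
split.
  split=> [|a b /= ay yb|a /= ay]; first by rewrite /= multiplicative1 perm1.
    by rewrite gmulfM permM ay.
  by rewrite multiplicativeV -[in LHS]ay permK.
pose stab (r : {perm Y}) : set G := [set h | (r^-1 * Phi h) y = y].
apply: (sub_finite_set _ (finite_image stab (@finite_finset _ setT))).
move=> _ [x _ <-]; exists (Phi x) => //; apply/seteqP.
split=> [h|_ [k Kk <-]]; rewrite /stab /=; last by rewrite gmulfM mulKg.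
move=> hE; exists (x^-1 * h); last by rewrite mulVKg.
by rewrite /= gmulfM multiplicativeV.
Qed.

(** * Finite quotients of subgroup separable groups *)

Lemma generated_is_subgroup (G : groupType) (S : set G) :
  is_subgroup (generated_subgroup S).
Proof.
split=> [B [[]]//|x y xS yS B BS|x xS B BS].
  by case: (BS) => -[_ BM _] _; apply: BM; [apply: xS|apply: yS].
by case: (BS) => -[_ _ BV] _; apply: BV; apply: xS.
Qed.

(** [A] acts on the finite set of left cosets of [K], and [B] is the group of all
    permutations of this set: if [k] lies in [K] and acts like [g], then [g] fixes the coset [K]. *)
Lemma finite_index_quotient (A : groupType) (K : set A) :
  is_subgroup K -> finite_index K ->
  exists (B : finGroupType) (rho : {multiplicative A -> B}),
    forall k g, K k -> rho k = rho g -> K g.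
Proof.
move=> [K1 KM KV] /finite_seqP[s sE].
have cosetE x : left_coset K x = [set z | K (x^-1 * z)].
  apply/seteqP; split=> [_ [k Kk <-]|z Kz] /=; first by rewrite mulKg.
  by exists (x^-1 * z) => //; rewrite mulVKg.
pose sh a (C : set A) : set A := [set z | C (a * z)].
have shs a (C : seq_sub s) : sh a (val C) \in s.
  have : [set` s] (val C) by apply: valP.
  rewrite -sE => -[x _ /esym CE].
  have : range (left_coset K) (left_coset K (a^-1 * x)) by exists (a^-1 * x).
  rewrite sE CE /= !cosetE; congr (_ \in s).
  by apply/funext => z; rewrite /sh /= invgM invgK mulgA.
have [|a b C|rho rhoE] :=
    @right_action_perm A (seq_sub s) (fun a C => SeqSub (shs a C)).
- by move=> C; apply/val_inj/funext => z; rewrite /= /sh /= mul1g.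
- by apply/val_inj/funext => z; rewrite /= /sh /= mulgA.
have Ks : K \in s.
  have : range (left_coset K) (left_coset K 1) by exists 1.
  rewrite sE cosetE /=; congr (_ \in s).
  by apply/funext => z /=; rewrite invg1 mul1g.
exists {perm (seq_sub s)}, rho => k g Kk.
move=> /(congr1 (fun r : {perm _} => val (r (SeqSub Ks)))).
rewrite !rhoE /= => /(congr1 (fun C : set A => C 1)); rewrite /sh /= !mulg1.
by move=> <-.
Qed.

(** A product of finite quotients, one for each pair in [l], separates all the
    pairs at once. *)
Lemma separable_seq_quotient (A : groupType) (l : seq (set A * A)) :
  subgroup_separable A ->
  exists (B : finGroupType) (rho : {multiplicative A -> B}),
    forall S g, (S, g) \in l -> finite_set S -> ~ generated_subgroup S g ->
    forall h, generated_subgroup S h -> rho h <> rho g.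
Proof.
move=> sepA; elim: l => [|[S g] l [B [rho rhoP]]].
  have [|//|rho _] := @right_action_perm A unit (fun _ u => u); first by [].
  by exists {perm unit}, rho.
have [[finS nSg]|nSg] := pselect (finite_set S /\ ~ generated_subgroup S g); last first.
  exists B, rho => S' g'; rewrite inE => /predU1P[[-> ->]|]; last exact: rhoP.
  by move=> finS' nS'; case: nSg.
have [|K [Ksub Kfin SK nKg]] := sepA _ (generated_is_subgroup S) _ _ nSg.
  by exists S.
have [B' [rho' rho'P]] := finite_index_quotient Ksub Kfin.
pose r a : B * B' := (rho a, rho' a).
have rM : {morph r : a b / a * b} by move=> a b; rewrite /r !gmulfM.
pose phi : {multiplicative A -> (B * B')%type} :=
  HB.pack r (isMultiplicative.Build A (B * B')%type r rM).
exists (B * B')%type, phi => S' g'; rewrite inE => /predU1P[[-> ->]|S'l].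
  by move=> _ _ h /SK Kh [_ /(rho'P _ _ Kh)].
by move=> finS' nS' h Sh [rE _]; apply: (rhoP _ _ S'l finS' nS' h).
Qed.


(** * Finite models of an action of one factor *)

Lemma orbit_representatives (A : groupType) (X : choiceType) (x0 : X)
    (act : X -> A -> X) :
  (forall x, act x 1 = x) -> (forall x a b, act x (a * b) = act (act x a) b) ->
  exists (c : X -> X) (p : X -> A),
    (forall x, act (c x) (p x) = x) /\ (forall x a, c (act x a) = c x).
Proof.
move=> act1 actM.
pose orb x : set X := [set y | exists a, act y a = x].
have orbP x : orb x (xget x0 (orb x)).
  by apply: xgetPex; exists x, 1.
have [p pP] := choice orbP.
exists (fun x => xget x0 (orb x)), p; split=> // x a; congr (xget x0 _).
apply/seteqP; split=> y [b yb]; last by exists (b * a); rewrite actM yb.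
by exists (b * a^-1); rewrite actM yb -actM mulgV act1.
Qed.

(** A point [x] is modelled by the name [c x] of its orbit together with the coset
    [im (c x) :* rho (p x)], where [im k] is the image of the subgroup generated by
    [S k] in a finite quotient [rho] of [A]. A step [(x, a)] of [D] is reproduced
    because [p x * a] and [p (act x a)] differ by a generator in [S (c x)]; two
    points of [F] in one orbit stay distinct because [rho] separates
    [p x * (p y)^-1] from that subgroup. *)
Lemma finite_model (A : groupType) (X : choiceType) (x0 : X)
    (act : X -> A -> X) (F : seq X) (D : set (X * A)) :
  subgroup_separable A ->
  (forall x, act x 1 = x) -> (forall x a b, act x (a * b) = act (act x a) b) ->
  finite_set D ->
  exists (Q : finType) (phi : {multiplicative A -> {perm Q}}) (eps : X -> Q),
    {in F &, injective eps} /\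
    forall x a, D (x, a) -> phi a (eps x) = eps (act x a).
Proof.
move=> sepA act1 actM finD.
have [c [p [cp cact]]] := orbit_representatives x0 act1 actM.
pose t (d : X * A) := p d.1 * d.2 * (p (act d.1 d.2))^-1.
pose S k := t @` (D `&` [set d | c d.1 = k]).
have finS k : finite_set (S k).
  by apply/finite_image/(sub_finite_set _ finD) => d [].
have S_stab k g : generated_subgroup (S k) g -> act k g = k.
  apply: (@smallest_sub _ _ _ [set g | act k g = k]).
    split=> [|a b /= ka kb|a /= ka]; first exact: act1.
      by rewrite actM ka.
    by rewrite -[in LHS]ka -actM mulgV act1.
  move=> _ [[x a] [_ /= <-] <-]; rewrite /t /= !actM cp.
  by rewrite -[X in act X _]cp cact -actM mulgV act1.
pose l := [seq (S (c x), p x * (p y)^-1) | x <- F, y <- F].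
have [B [rho rhoP]] := separable_seq_quotient l sepA.
pose im k : {set B} :=
  finset (fun z => `[< exists2 h, generated_subgroup (S k) h & rho h = z >]).
have imP k z : reflect (exists2 h, generated_subgroup (S k) h & rho h = z)
    (z \in im k) by rewrite inE; apply: asboolP.
(* Orbits that do not meet [F] all get the name [None]: only the points of [F]
   have to be kept apart. *)
pose Q : finType := (option (seq_sub (map c F)) * {set B})%type.
have [|q a b|phi phiE] :=
  @right_action_perm A Q (fun a q => (q.1, q.2 :* rho a)).
- by case=> o Z; rewrite multiplicative1 rcoset1.
- by rewrite gmulfM rcosetM.
exists Q, phi, (fun x => (insub (c x), im (c x) :* rho (p x))).
split=> [x y xF yF []|x a Dxa].
  rewrite !insubT ?map_f// => cxF cyF [cxy] xy.
  have [//|nxy] := eqVneq x y.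
  have /imP[h Sh rh] : rho (p x) * (rho (p y))^-1 \in im (c x).
    rewrite -mem_rcoset cxy -xy mem_rcoset mulgV; apply/imP.
    exists 1; last exact: multiplicative1.
    by have [] := generated_is_subgroup (S (c x)).
  case: (rhoP (S (c x)) (p x * (p y)^-1) _ _ _ h) => //.
  - exact: allpairs_f.
  - move=> /S_stab/eqP; rewrite actM cp => /eqP cxE; case/eqP: nxy.
    by rewrite -(cp y) -cxy -cxE -actM mulVg act1.
  - by rewrite gmulfM multiplicativeV.
rewrite phiE /= cact; congr pair; apply/setP => z.
have [S1 SM SV] := generated_is_subgroup (S (c x)).
have St : generated_subgroup (S (c x)) (t (x, a)).
  by apply: sub_gen_smallest; exists (x, a).
rewrite !mem_rcoset.
have -> : z * (rho a)^-1 * (rho (p x))^-1 =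
    z * (rho (p (act x a)))^-1 * (rho (t (x, a)))^-1.
  by rewrite /t /= !gmulfM multiplicativeV !invgM invgK !mulgA mulgKV.
apply/imP/imP => -[h Sh rh].
  by exists (h * t (x, a)); [apply: SM|rewrite gmulfM rh mulgKV].
exists (h * (t (x, a))^-1); first by apply: SM => //; apply: SV.
by rewrite gmulfM rh multiplicativeV.
Qed.


(** * Gluing actions of the factors *)

(** The sets [Q i] are glued along their copies of [F]: the disjoint union of [F]
    and all the [Q i] receives each [Q i] by the injection [j i], which sends the
    copy of a point of [F] to that point. The elements of [Q i] in that copy then
    also appear as unused points, which is harmless. *)
Lemma amalgamate (I : finType) (As : I -> groupType) (X : choiceType)
    (F : seq X) (Q : I -> finType)
    (phi : forall i, {multiplicative As i -> {perm (Q i)}})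
    (eps : forall i, X -> Q i) :
  (forall i, {in F &, injective (eps i)}) ->
  exists (Y : finType) (psi : forall i, {multiplicative As i -> {perm Y}})
      (e : X -> Y),
    {in F &, injective e} /\
    forall i x y a, x \in F -> y \in F -> phi i a (eps i x) = eps i y ->
      psi i a (e x) = e y.
Proof.
move=> epsI.
(* [None] is the value of [e] outside [F]. *)
pose Y : finType := (option (seq_sub F) + {i : I & Q i})%type.
pose e x : Y := inl (insub x).
pose j i q : Y := if [pick x : seq_sub F | eps i (val x) == q] is Some x
  then inl (Some x) else inr (Tagged Q q).
have jI i : injective (j i).
  move=> q q'; rewrite /j; case: pickP => [x /eqP <-|_]; case: pickP => //.
    by move=> y /eqP <- [<-].
  by move=> _ [E]; apply: (@eq_from_Tagged I (fun i => Q i)) E.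
have je i x : x \in F -> j i (eps i x) = e x.
  move=> xF; rewrite /j /e; case: pickP => [y /eqP/epsI|/(_ (SeqSub xF))].
    by move=> <- //; rewrite ?valK//; apply: valP.
  by rewrite eqxx.
have [psi psiP] := all_sig (fun i => cid (extend_perm_rep (phi i) (jI i))).
exists Y, psi, e; split=> [x y xF yF|i x y a xF yF xay].
  by rewrite /e !insubT => -[].
by rewrite -!(je i) // psiP xay.
Qed.

(** * Free products *)

(** The proof [hL] is a parameter so that it is available to the group structure
    declared on this type. *)
Definition subgroup_carrier (G : groupType) (L : set G) (hL : is_subgroup L) :=
  {x : G | `[< L x >]}.

Section SubgroupGroup.
Variables (G : groupType) (L : set G) (hL : is_subgroup L).
HB.instance Definition _ := SubChoice.on (subgroup_carrier hL).
Lemma subgroup_carrier_closed : group_closed (fun x : G => `[< L x >]).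
Proof.
case: hL => L1 LM LV; split=> [|x y]; first exact/asboolP.
by move=> /asboolP Lx /asboolP Ly; apply/asboolP/LM => //; apply: LV.
Qed.
HB.instance Definition _ := SubChoice_isSubGroup.Build G _ (subgroup_carrier hL)
  subgroup_carrier_closed.
End SubgroupGroup.

(** The canonical maps factor through [L], so the universal property gives a map
    from [G] to [L]. Followed by the inclusion it agrees with the identity of [G]
    on the factors, hence everywhere. *)
Lemma free_product_generated (I : Type) (Gs : I -> groupType) (G : groupType)
    (iota : forall i, {multiplicative Gs i -> G}) (L : set G) :
  is_free_product iota -> is_subgroup L -> (forall i x, L (iota i x)) ->
  forall g, L g.
Proof.
move=> hG hL Li.
pose T : groupType := subgroup_carrier hL.
pose f i x : T := exist _ (iota i x) (introT (asboolP _) (Li i x)).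
have fM i : {morph f i : x y / x * y}.
  by move=> x y; apply/val_inj; rewrite /= gmulfM.
pose F i : {multiplicative Gs i -> T} :=
  HB.pack (f i) (isMultiplicative.Build (Gs i) T (f i) (fM i)).
have [[phi phiE] _] := hG T F.
pose incl : {multiplicative T -> G} := \val.
have [_ uniq] := hG G iota.
move=> g.
have /= <- := uniq (incl \o phi : {multiplicative G -> G})
  (idfun : {multiplicative G -> G}) _ _ g.
- by apply/asboolP; case: (phi g).
- by move=> i x; rewrite /= phiE.
- by [].
Qed.

(** A map [e] from [X] to a finite action commutes with [g] at [x] as soon as it
    does so on finitely many steps [(y, a)] with [a] in a factor. The elements [g]
    with this property form a subgroup, so it is enough to check the factors. *)
Lemma finitely_many_conditions (I : eqType) (Gs : I -> groupType)
    (G : groupType) (iota : forall i, {multiplicative Gs i -> G})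
    (X : choiceType) (act : X -> G -> X) :
  is_free_product iota ->
  (forall x, act x 1 = x) -> (forall x a b, act x (a * b) = act (act x a) b) ->
  forall g x, exists C : seq (X * {i & Gs i}),
    forall (Y : finType) (Phi : {multiplicative G -> {perm Y}}) (e : X -> Y),
      (forall y i a, (y, Tagged Gs a) \in C ->
         Phi (iota i a) (e y) = e (act y (iota i a))) ->
      Phi g (e x) = e (act x g).
Proof.
move=> hG act1 actM.
apply: (free_product_generated hG) => [|i a x]; last first.
  by exists [:: (x, Tagged Gs a)] => Y Phi e; apply; rewrite inE.
split=> [x|g h Pg Ph x|g Pg x].
- by exists [::] => Y Phi e _; rewrite multiplicative1 perm1 act1.
- have [C CP] := Pg x; have [C' C'P] := Ph (act x g).
  exists (C ++ C') => Y Phi e eP; rewrite gmulfM permM actM.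
  by rewrite CP ?C'P// => y i a yC; apply: eP; rewrite mem_cat yC ?orbT.
- have [C CP] := Pg (act x g^-1); exists C => Y Phi e /CP.
  by rewrite -actM mulVg act1 multiplicativeV => <-; rewrite permK.
Qed.

Theorem mainTheorem1 (n : nat) (Gs : 'I_n -> groupType) (G : groupType)
    (iota : forall i : 'I_n, {multiplicative Gs i -> G})
    (hG : is_free_product iota)
    (hGs : forall i : 'I_n, subgroup_separable (Gs i)) :
  subgroup_separable G.
Proof.
move=> H [H1 HM HV] [S [/finite_seqP[s ->] HS]] g nHg.
(* [G] acts on all its subsets by right translation: the translates of [H] are its
   right cosets, and the stabilizer of [H] is [H]. *)
pose act (x : set G) (a : G) : set G := [set z | x (z * a^-1)].
have act1 x : act x 1 = x by apply/funext => z; rewrite /act /= invg1 mulg1.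
have actM x a b : act x (a * b) = act (act x a) b.
  by apply/funext => z; rewrite /act /= invgM mulgA.
have actH h : H h -> act H h = H.
  move=> Hh; apply/seteqP; split=> z; rewrite /act /=; last first.
    by move=> Hz; apply: HM => //; apply: HV.
  by move=> /HM/(_ Hh); rewrite mulgKV.
have actNH : act H g <> H.
  move=> /(congr1 (fun K : set G => K g)); rewrite /act /= mulgV => HE.
  by apply: nHg; rewrite -HE.
(* The steps needed to follow [g] and the generators of [H] from the coset [H],
   and the cosets that these steps join. *)
have [C CP] := choice (fun h => finitely_many_conditions hG act1 actM h H).
pose Cs := flatten [seq C h | h <- g :: s].
pose F := [:: H; act H g] ++ [seq c.1 | c <- Cs]
  ++ [seq act c.1 (iota (tag c.2) (tagged c.2)) | c <- Cs].
pose D i : set (set G * Gs i) := [set d | (d.1, Tagged Gs d.2) \in Cs].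
have finD i : finite_set (D i).
  apply: (@finite_preimage _ _ [set` Cs]
    (fun d : set G * Gs i => (d.1, Tagged Gs d.2))); last exact: finite_seq.
  by move=> [x a] [y b] _ _ /= [-> E]; rewrite (eq_from_Tagged E).
(* Packing the model as one sigma type lets a single choice pick it for every
   factor. *)
have model i : exists m : {Q : finType & ({multiplicative Gs i -> {perm Q}}
    * (set G -> Q))%type},
    {in F &, injective (projT2 m).2} /\
    forall x a, D i (x, a) ->
      (projT2 m).1 a ((projT2 m).2 x) = (projT2 m).2 (act x (iota i a)).
  have [||Q [phi [e [eI eP]]]] := @finite_model (Gs i) (set G) H
    (fun x a => act x (iota i a)) F (D i) (hGs i) _ _ (finD i).
  - by move=> x; rewrite multiplicative1.
  - by move=> x a b; rewrite gmulfM.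
  - by exists (existT _ Q (phi, e)).
have [m mP] := all_sig (fun i => cid (model i)).
have [Y [psi [e [eI psiE]]]] := amalgamate
  (fun i => (projT2 (m i)).1) (fun i => (mP i).1).
(* The actions of the factors on [Y] extend to an action of [G]. *)
have [[Phi PhiE] _] := hG {perm Y} psi.
have Phi_act h : h \in g :: s -> Phi h (e H) = e (act H h).
  move=> hs; apply: CP => x i a xC.
  have xCs : (x, Tagged Gs a) \in Cs.
    by apply/flattenP; exists (C h) => //; apply: map_f.
  rewrite PhiE; apply: psiE; last exact: (mP i).2.
  - by rewrite !mem_cat (map_f fst xCs) orbT.
  - rewrite !mem_cat; apply/orP; right; apply/orP; right.
    exact: (map_f (fun c : set G * {i & Gs i} =>
      act c.1 (iota (tag c.2) (tagged c.2))) xCs).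
have [Kgrp Kfin] := point_stabilizer Phi (e H).
exists [set h | Phi h (e H) = e H]; split=> //.
- rewrite [X in X `<=` _]HS; apply: smallest_sub => // h hs /=.
  rewrite Phi_act ?inE ?hs ?orbT// actH// HS; exact: sub_gen_smallest.
- rewrite /= Phi_act ?mem_head// => /eI actHE; apply/actNH/actHE.
  + by rewrite !inE eqxx orbT.
  + by rewrite !inE eqxx.
Qed.
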